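(* Let $\mathbf g\colon\mathbb R^2_{>0}\to\mathbb R^2_{>0}$ be a $\mathcal C^2$ map with fixed point $\mathbf y^*>\mathbf 0$, such that $r\mathbf y^*$ is a fixed point of $\mathbf g$ for all $r>0$. In addition, let the iterates of the iteration scheme $\mathbf y^{n+1}=\mathbf g(\mathbf y^n)$ satisfy $\lVert \mathbf y^{n+1}\rVert_1=\lVert \mathbf y^n\rVert_1$ for all $n\in\mathbb N_0$. Then the spectrum of the Jacobian $\mathbf D\mathbf g(\mathbf y^* )$ is $\sigma(\mathbf D\mathbf g(\mathbf y^* ))=\{1,R\}$ with $R\in\mathbb R$, and the following statements apply. a) If $\lvert R\rvert<1$, then $\mathbf y^*$ is stable. b) If $\mathbf y^*$ is stable, then there exists a $\delta>0$ such that $\lVert\mathbf y^0\rVert_1=\lVert\mathbf y^*\rVert_1$ and $\lVert\mathbf y^0-\mathbf y^*\rVert<\delta$ imply $\mathbf y^n\to\mathbf y^*$ as $n\to\infty$.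
   Context: $\mathbb R^2_{>0}$ is the set of vectors in $\mathbb R^2$ with both components positive, and $\mathbf y^*>\mathbf 0$ means $\mathbf y^*\in\mathbb R^2_{>0}$. The iteration scheme $\mathbf y^{n+1}=\mathbf g(\mathbf y^n)$ is considered for arbitrary starting values $\mathbf y^0\in\mathbb R^2_{>0}$. $\lVert\cdot\rVert$ is an arbitrary norm on $\mathbb R^2$ and $\lVert\cdot\rVert_1$ is the 1-norm. $\mathbf D\mathbf g$ denotes the Jacobian of $\mathbf g$. A fixed point $\mathbf y^*$ of the iteration scheme $\mathbf y^{n+1}=\mathbf g(\mathbf y^n)$ is called (Lyapunov) stable if for every $\epsilon>0$ there exists $\delta=\delta(\epsilon)>0$ such that $\lVert\mathbf y^0-\mathbf y^*\rVert<\delta$ implies $\lVert\mathbf y^n-\mathbf y^*\rVert<\epsilon$ for all $n\ge 0$.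
   Formalization: Part b) is proved under the added hypothesis |R| ≠ 1; as printed it is false: the identity map (R = 1) and the swap of coordinates with y* = (1,1) (R = -1) meet all hypotheses with y* stable, but nearby iterates do not converge to y*. *)

(* Defs.v *)
From HB Require Import structures.
From mathcomp Require Import all_boot all_order all_algebra.
From mathcomp Require Import all_classical all_reals all_analysis.
From mathcomp.real_closed Require Import complex.

Set Implicit Arguments.
Unset Strict Implicit.
Unset Printing Implicit Defensive.

Import Order.TTheory GRing.Theory Num.Theory.
Import numFieldNormedType.Exports.

Local Open Scope classical_set_scope.
Local Open Scope ring_scope.

(* Vectors of R^2 are row vectors, so that ['J g y] acts on the right:
   [v *m 'J g y = 'D_v g y]. *)
Definition pos_quadrant (R : realType) : set 'rV[R]_2 :=
  [set y | forall i, 0 < y 0 i].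
Arguments pos_quadrant : clear implicits.

Definition is_norm (R : realType) (n : nat) (N : 'rV[R]_n -> R) : Prop :=
  [/\ forall x y, N (x + y) <= N x + N y,
      forall (a : R) x, N (a *: x) = `|a| * N x &
      forall x, N x = 0 -> x = 0].

(* The library norm [`|x|] on matrices is the sup norm. *)
Definition norm1 (R : realType) (n : nat) (x : 'rV[R]_n) : R :=
  \sum_i `|x 0 i|.

(* C^k maps on an open subset U of a finite-dimensional space.  For x in U,
   ['D_v f x] only depends on f near x, so values of f off U are irrelevant. *)
Fixpoint Ck_on (R : realType) (V W : normedModType R) (U : set V) (k : nat)
    (f : V -> W) : Prop :=
  match k with
  | 0%N => forall x, U x -> {for x, continuous f}
  | k'.+1 => (forall x, U x -> differentiable f x) /\
             (forall v : V, Ck_on U k' ('D_v f))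
  end.

(* The spectrum of a real matrix is taken in the complex numbers. *)
Definition spectrum (R : realType) (n : nat) (A : 'M[R]_n) : set R[i] :=
  [set l | eigenvalue (map_mx (real_complex R) A) l].

(* The starting values are confined to D, on which the iteration is defined. *)
Definition lyapunov_stable (R : realType) (n : nat) (N : 'rV[R]_n -> R)
    (D : set 'rV[R]_n) (g : 'rV[R]_n -> 'rV[R]_n) (ystar : 'rV[R]_n) : Prop :=
  forall eps : R, 0 < eps ->
  exists2 delta : R, 0 < delta &
    forall y0, D y0 -> N (y0 - ystar) < delta ->
    forall k : nat, N (iter k g y0 - ystar) < eps.

(* Main.v *)
Require Import Defs.
From HB Require Import structures.
From mathcomp Require Import all_boot all_order all_algebra.
From mathcomp Require Import all_classical all_reals all_analysis.
From mathcomp.real_closed Require Import complex.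
From mathcomp Require Import ring lra.

Set Implicit Arguments.
Unset Strict Implicit.
Unset Printing Implicit Defensive.

Import Order.TTheory GRing.Theory Num.Theory.
Import numFieldNormedType.Exports.

Local Open Scope classical_set_scope.
Local Open Scope complex_scope.
Local Open Scope ring_scope.

(** The map preserves the sum of the two coordinates of a positive vector, so
    it acts on each line of direction w = (1, -1) separately. Write
    y = r y* + t w. The number r is determined by the sum of y, hence is
    constant along an orbit, and t = 0 is a fixed point on every line because
    the ray through y* is fixed. The plane problem is thus a family, indexed by
    r, of one-dimensional problems t |-> phi_r(t) with phi_r(0) = 0.

    The derivative of phi_1 at 0 is the number rho with w J = rho w, where J is
    the Jacobian at y*. Since y* J = y* by differentiation along the ray, and
    y*, w form a basis, the spectrum of J is {1, rho}.

    The derivative in direction w is continuous, so the mean value theorem on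
    the segment from r y* to r y* + t w gives phi_r(t) = m t with m as close to
    rho as desired, uniformly for r near 1 and t near 0 (lemma
    [local_multiplier]). Uniformity in r matters because a perturbation of y*
    also moves the line.

    - If |rho| < 1, then t shrinks geometrically on all the lines with r near 1
      ([contraction_near]). As r does not move, y* is stable; on the line r = 1
      the orbit converges to y*.
    - If |rho| > 1, then t grows geometrically as long as it stays small
      ([expansion_near]), so an orbit on the line r = 1 that stays near y*
      has t = 0. Stability makes this apply to every start close to y*: the
      only such start is y* itself, and convergence is trivial.

    Neighbourhoods for the given norm are compared with bounds on r - 1 and t
    through the equivalence of norms in finite dimension ([is_norm_ge],
    [ray_coordinates]). *)

(** * Total and transfer coordinates of the plane *)

Definition total (K : pzRingType) (y : 'rV[K]_2) : K := y 0 0 + y 0 1.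

(** The direction (1, -1) of the lines on which the total is constant. *)
Definition transfer (K : pzRingType) : 'rV[K]_2 := \row_j (-1) ^+ j.
Arguments transfer {K}.

Lemma totalD (K : pzRingType) (x y : 'rV[K]_2) :
  total (x + y) = total x + total y.
Proof. by rewrite /total !mxE addrACA. Qed.

Lemma totalZ (K : pzRingType) (a : K) (x : 'rV[K]_2) :
  total (a *: x) = a * total x.
Proof. by rewrite /total !mxE mulrDr. Qed.

Lemma totalB (K : pzRingType) (x y : 'rV[K]_2) :
  total (x - y) = total x - total y.
Proof. by rewrite totalD -scaleN1r totalZ mulN1r. Qed.

Lemma transfer00 (K : pzRingType) : transfer 0 0 = 1 :> K.
Proof. by rewrite mxE expr0. Qed.

Lemma total_transfer (K : pzRingType) : total transfer = 0 :> K.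
Proof. by rewrite /total !mxE expr0 expr1 subrr. Qed.

Lemma total0_transfer (K : pzRingType) (x : 'rV[K]_2) :
  total x = 0 -> x = x 0 0 *: transfer.
Proof.
rewrite /total => /eqP; rewrite addrC addr_eq0 => /eqP x0.
apply/rowP => -[[|[|//]] i2].
  by rewrite !mxE expr0 mulr1; congr (x _ _); apply/val_inj.
rewrite !mxE expr1 mulrN1 -x0; congr (x _ _); exact/val_inj.
Qed.

(** A vector of nonzero total and [transfer] form a basis; the first
    coordinate in this basis is read off from the total alone. *)
Lemma total_decomposition (K : fieldType) (y x : 'rV[K]_2) :
    total y != 0 ->
  x = (total x / total y) *: y
      + (x - (total x / total y) *: y) 0 0 *: transfer.
Proof.
move=> y0; rewrite -total0_transfer ?subrKC//.
by rewrite totalB totalZ divfK// subrr.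
Qed.

(** * The spectrum of a matrix with a known eigenbasis *)

(** Both basis vectors of [total_decomposition] are eigenvectors, so an
    eigenvector for [l], expanded in that basis, forces [l] to be one of the
    two eigenvalues. The field is arbitrary because the spectrum of a real
    matrix is computed over the complex numbers. *)
Lemma eigenvalue_transfer (K : fieldType) (A : 'M[K]_2) (y : 'rV[K]_2)
    (rho l : K) :
    total y != 0 -> y *m A = y -> transfer *m A = rho *: transfer ->
  eigenvalue A l <-> l = 1 \/ l = rho.
Proof.
move=> y0 yA tA; split.
  move=> /eigenvalueP[v vA v0].
  have := total_decomposition v y0.
  set a := _ / _; set b := (X in _ + X *: _); clearbody a b => vE.
  have lE : a *: y + (b * rho) *: transfer = (l * a) *: y + (l * b) *: transfer.
    by rewrite -!scalerA -scalerDr -vE -vA vE mulmxDl -!scalemxAl yA tA.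
  have /eqP := congr1 (@total K) lE.
  rewrite !totalD !totalZ !total_transfer !mulr0 !addr0 -subr_eq0 -mulrBl.
  rewrite mulf_eq0 (negbTE y0) orbF => /eqP aE.
  have [a0|a0] := eqVneq a 0.
    right; move: lE; rewrite a0 mulr0 scale0r !add0r.
    move=> /(congr1 (fun z : 'rV_2 => z 0 0)).
    rewrite mxE [RHS]mxE transfer00 !mulr1 mulrC.
    have [b0|b0] := eqVneq b 0.
      by move: v0; rewrite vE a0 b0 !scale0r addr0 eqxx.
    by move=> /(mulIf b0).
  left; apply: (mulIf a0); rewrite mul1r.
  by apply/esym/eqP; rewrite -subr_eq0 aE.
case=> ->; apply/eigenvalueP.
  exists y; rewrite ?scale1r//; apply: contraNneq y0 => ->.
  by rewrite /total !mxE addr0.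
exists transfer => //; apply/eqP => /(congr1 (fun z : 'rV_2 => z 0 0)).
by rewrite transfer00 mxE => /eqP; rewrite oner_eq0.
Qed.

Lemma spectrum_transfer (R : realType) (A : 'M[R]_2) (y : 'rV[R]_2) (rho : R) :
    total y != 0 -> y *m A = y -> transfer *m A = rho *: transfer ->
  spectrum A = [set 1; rho%:C].
Proof.
move=> y0 yA tA; apply/funext => l; apply/propext.
pose f : {rmorphism R -> R[i]} := real_complex R.
have ft : map_mx f transfer = transfer.
  by apply/rowP => i; rewrite !mxE rmorphXn rmorphN1.
apply: (@eigenvalue_transfer _ (map_mx f A) (map_mx f y) (f rho)).
- by rewrite /total !mxE -rmorphD/= fmorph_eq0.
- by rewrite -map_mxM yA.
- by rewrite -ft -map_mxM tA map_mxZ.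
Qed.

(** * Comparison of norms on row vectors *)

Lemma cvg_coord (R : realType) (n : nat) (T : Type) (F : set_system T)
    (FF : Filter F) (f : T -> 'rV[R]_n) (l : 'rV[R]_n) i :
  f x @[x --> F] --> l -> f x 0 i @[x --> F] --> l 0 i.
Proof.
by move=> fl; exact: (cvg_comp f (fun z : 'rV[R]_n => z 0 i) fl
  (@coord_continuous R 1 n 0 i l)).
Qed.

Section norm_comparison.
Context {R : realType} {n : nat}.
Implicit Types (x : 'rV[R]_n) (N : 'rV[R]_n -> R).

Lemma ler_coord_norm x i : `|x 0 i| <= `|x|.
Proof.
rewrite [leRHS]/Num.Def.normr/= mx_normrE.
exact: (le_bigmax _ (fun j : 'I_1 * 'I_n => `|x j.1 j.2|) (0, i)).
Qed.

Lemma is_norm0 N : is_norm N -> N 0 = 0.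
Proof. by move=> [_ NZ _]; rewrite -(scale0r 0) NZ normr0 mul0r. Qed.

Lemma is_norm_ge0 N x : is_norm N -> 0 <= N x.
Proof.
move=> Nn; have [ND NZ _] := Nn.
have := ND x (- x); rewrite subrr is_norm0// -scaleN1r NZ normrN1 mul1r.
lra.
Qed.

(** The constant is the sum of the norms of the basis vectors, plus 1 to make
    it positive in dimension 0. *)
Lemma is_norm_le N : is_norm N -> exists2 K, 0 < K & forall x, N x <= K * `|x|.
Proof.
move=> Nn; have [ND NZ _] := Nn.
have NS (s : seq 'I_n) (F : 'I_n -> 'rV[R]_n) :
    N (\sum_(i <- s) F i) <= \sum_(i <- s) N (F i).
  elim: s => [|i s IHs]; first by rewrite !big_nil is_norm0.
  by rewrite !big_cons (le_trans (ND _ _))// lerD2l.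
have S0 : 0 <= \sum_i N (delta_mx 0 i).
  by apply: sumr_ge0 => i _; exact: is_norm_ge0.
exists (1 + \sum_i N (delta_mx 0 i)) => [|x]; first by rewrite ltr_pwDl.
rewrite {1}(row_sum_delta x) (le_trans (NS _ _))//.
apply: (@le_trans _ _ (\sum_i N (delta_mx 0 i) * `|x|)).
  apply: ler_sum => i _; rewrite NZ mulrC ler_wpM2l ?ler_coord_norm//.
  exact: is_norm_ge0.
by rewrite -mulr_suml ler_wpM2r// lerDr.
Qed.

Lemma is_norm_continuous N : is_norm N -> continuous N.
Proof.
move=> Nn; have [ND NZ _] := Nn; have [K K0 NK] := is_norm_le Nn.
move=> x; apply/(@cvgrPdist_lt _ _ _ (nbhs x)) => e e0; near=> y.
have NB u v : N u - N v <= N (u - v) by rewrite lerBlDr -{1}(subrK v u) ND.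
have NC u v : N (u - v) = N (v - u).
  by rewrite -opprB -scaleN1r NZ normrN1 mul1r.
apply: (@le_lt_trans _ _ (N (x - y))).
  by rewrite ler_norml NB andbT lerNl opprB NC NB.
rewrite (le_lt_trans (NK _))// mulrC -ltr_pdivlMr//.
near: y; apply: (@cvgr_dist_lt _ _ _ (nbhs x) _ id x); first exact: cvg_id.
by rewrite divr_gt0.
Unshelve. all: by end_near. Qed.

(** The other half of the equivalence of norms: [N] is continuous, hence has a
    minimum on the compact unit sphere of the sup norm; it is positive by
    definiteness, and homogeneity extends the bound to all vectors. *)
Lemma is_norm_ge N : is_norm N -> exists2 K, 0 < K & forall x, `|x| <= K * N x.
Proof.
move=> Nn; have [_ NZ N0] := Nn.
pose S := [set x : 'rV[R]_n | `|x| = 1].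
have scaleS x : x != 0 -> S (`|x|^-1 *: x).
  move=> x0; rewrite /S/= normrZ ger0_norm ?invr_ge0// mulVf//.
  by rewrite normr_eq0.
(* The sphere is empty in dimension 0. *)
have [Se|S0] := pselect (S !=set0); last first.
  exists 1 => // x; have [->|x0] := eqVneq x 0.
    by rewrite normr0 mul1r is_norm_ge0.
  by case: S0; exists (`|x|^-1 *: x); exact: scaleS.
have Sc : compact S.
  apply: bounded_closed_compact.
    by exists 1; split=> // M M1 x /= ->; exact: ltW.
  have -> : S = Num.Def.normr @^-1` [set 1] by [].
  by apply: closed_comp => [x _|]; [exact: norm_continuous|exact: closed_eq].
have [c cS cmin] := EVT_min_rV Se Sc
  (continuous_subspaceT (is_norm_continuous Nn)).
have Nc : 0 < N c.
  rewrite lt_def is_norm_ge0// andbT; apply/eqP => /N0 c0.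
  by move: cS; rewrite c0 inE /S/= normr0 => /eqP; rewrite eq_sym oner_eq0.
exists (N c)^-1 => [|x]; first by rewrite invr_gt0.
have [->|x0] := eqVneq x 0.
  by rewrite normr0 mulr_ge0 ?is_norm_ge0// invr_ge0 ltW.
rewrite mulrC ler_pdivlMr// mulrC -ler_pdivlMr ?normr_gt0//.
have := cmin (`|x|^-1 *: x); rewrite inE => /(_ (scaleS _ x0)).
by rewrite NZ ger0_norm ?invr_ge0// mulrC.
Qed.

End norm_comparison.

(** * The positive quadrant *)

Lemma pos_quadrant_open (R : realType) : open (pos_quadrant R).
Proof.
rewrite openE => y ypos.
have : \forall z \near y, forall i, 0 < (z : 'rV[R]_2) 0 i; last exact.
apply: (@filter_forall _ _ (fun i (z : 'rV[R]_2) => 0 < z 0 i) (nbhs y)) => i.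
have cy : (z : 'rV[R]_2) 0 i @[z --> y] --> (y : 'rV[R]_2) 0 i.
  exact: coord_continuous.
exact: (@cvgr_gt _ _ (nbhs y) _ _ _ cy 0 (ypos i)).
Qed.

Lemma norm1_total (R : realType) (y : 'rV[R]_2) :
  pos_quadrant R y -> norm1 y = total y.
Proof.
move=> ypos; rewrite /norm1 !big_ord_recl big_ord0 addr0 /total.
rewrite !gtr0_norm//; congr (_ + y _ _); exact/val_inj.
Qed.

Lemma total_gt0 (R : realType) (y : 'rV[R]_2) :
  pos_quadrant R y -> 0 < total y.
Proof. by move=> ypos; rewrite addr_gt0. Qed.

(** * Directional derivatives of maps of the plane *)

Section directional_derivative.
Context {R : realType}.
Implicit Types (g : 'rV[R]_2 -> 'rV[R]_2) (y v : 'rV[R]_2).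

(** The total is linear and continuous, so it passes to the limit in the
    difference quotient, whose total is that of [v] once [g] preserves
    totals. *)
Lemma total_derive g y v : derivable g y v ->
    (\forall x \near y, total (g x) = total x) ->
  total ('D_v g y) = total v.
Proof.
move=> dg gt.
pose q (h : R) := h^-1 *: ((g \o shift y) (h *: v) - g y).
have qD : q h @[h --> 0^'] --> 'D_v g y by exact: dg.
have tD : total (q h) @[h --> 0^'] --> total ('D_v g y).
  by apply: cvgD; exact: cvg_coord qD.
have tv : total (q h) @[h --> 0^'] --> total v.
  have hy : (h *: v + y) @[h --> (0 : R)] --> y.
    suff : (h *: v + y) @[h --> (0 : R)] --> 0 *: v + y.
      by rewrite scale0r add0r.
    by apply: cvgD; [exact: scalel_continuous|exact: cvg_cst].
  apply: cvg_near_cst; near=> h.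
  have h0 : h != 0 by near: h; exact: nbhs_dnbhs_neq.
  have gy : total (g y) = total y by exact: (nbhs_singleton gt).
  have gh : total (g (h *: v + y)) = total (h *: v + y).
    by near: h; apply: cvg_within; exact: (hy _ gt).
  by rewrite /q totalZ totalB /= gh gy totalD totalZ addrK mulKf.
exact: (cvg_unique _ tD tv).
Unshelve. all: by end_near. Qed.

Lemma derive_affine g y v :
  (\forall h \near (0 : R), g (h *: v + y) = h *: v + g y) -> 'D_v g y = v.
Proof.
move=> gv; apply/cvg_lim => //; apply: cvg_near_cst; near=> h.
have h0 : h != 0 by near: h; exact: nbhs_dnbhs_neq.
have -> : (g \o shift y) (h *: v) = h *: v + g y.
  by near: h; apply: cvg_within; exact: gv.
by rewrite addrK scalerA mulVf// scale1r.
Unshelve. all: by end_near. Qed.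

Lemma is_derive_coord g y v i (s : R) : derivable g (s *: v + y) v ->
  is_derive s 1 (fun s : R => g (s *: v + y) 0 i) (('D_v g (s *: v + y)) 0 i).
Proof.
move=> dg.
pose q (h : R) := h^-1 *: ((g \o shift (s *: v + y)) (h *: v) - g (s *: v + y)).
have qD : q h @[h --> 0^'] --> 'D_v g (s *: v + y) by exact: dg.
have qiD : (q h) 0 i @[h --> 0^'] --> ('D_v g (s *: v + y)) 0 i.
  exact: cvg_coord qD.
have qE : (fun h : R => h^-1 *: (((fun s : R => g (s *: v + y) 0 i) \o shift s)
    (h *: (1 : R)) - g (s *: v + y) 0 i)) = (fun h => (q h) 0 i).
  apply/funext => h; rewrite /q !mxE /=.
  by rewrite addrA -scalerDl [h *: 1]mulr1.
apply: DeriveDef.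
  by rewrite /derivable qE; apply/cvg_ex; eexists; exact: qiD.
by rewrite /derive qE; apply/cvg_lim.
Qed.

(** The mean value theorem holds for each coordinate separately, with an
    intermediate point that depends on the coordinate. This is enough where
    the increment is a multiple of [transfer], as one coordinate then
    determines it. *)
Lemma segment_mean_value g y v i :
    (forall s : R, 0 <= s <= 1 -> differentiable g (s *: v + y)) ->
  exists2 s : R, 0 <= s <= 1 &
    g (v + y) 0 i = g y 0 i + ('D_v g (s *: v + y)) 0 i.
Proof.
move=> dg.
have dgi (s : R) : 0 <= s <= 1 ->
    is_derive s 1 (fun s : R => g (s *: v + y) 0 i)
      (('D_v g (s *: v + y)) 0 i).
  by move=> /dg s01; apply: is_derive_coord; exact: diff_derivable.
have [||s s01] := @MVT_segment R (fun s => g (s *: v + y) 0 i)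
  (fun s => ('D_v g (s *: v + y)) 0 i) 0 1 ler01.
- move=> s; rewrite in_itv/= => /andP[s0 s1]; apply: dgi.
  by rewrite !ltW.
- apply: continuous_in_subspaceT => s; rewrite inE/= in_itv/= => s01.
  apply: differentiable_continuous; apply/derivable1_diffP.
  by have [] := dgi s s01.
rewrite subr0 mulr1 scale1r scale0r add0r => gE.
exists s; first by rewrite in_itv/= in s01.
by rewrite -gE subrKC.
Qed.

End directional_derivative.

(** * Iteration on an affine line through a fixed point *)

Section line_iteration.
Context {R : realType} {V : lmodType R}.
Variables (g : V -> V) (a w : V) (q eta : R).

(** The bound [q <= 1] keeps the orbit in the interval of radius [eta] where
    the estimate on the multiplier is available. *)
Lemma iter_contracting (t : R) :
    0 <= q <= 1 ->
    (forall s, `|s| < eta ->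
       exists2 m : R, `|m| <= q & g (a + s *: w) = a + (m * s) *: w) ->
    `|t| < eta ->
  forall n, exists2 u, `|u| <= q ^+ n * `|t| &
    iter n g (a + t *: w) = a + u *: w.
Proof.
move=> /andP[q0 q1] gq t_eta; elim=> [|n [u un IHn]].
  by exists t => //; rewrite expr0 mul1r.
have u_eta : `|u| < eta.
  by rewrite (le_lt_trans un)// (le_lt_trans _ t_eta)// ler_piMl// exprn_ile1.
have [m mq gu] := gq u u_eta.
exists (m * u); last by rewrite iterS IHn.
by rewrite normrM exprS -mulrA ler_pM.
Qed.

(** As long as the orbit stays within [eta], its coordinate is at least
    [q ^+ n * `|t|], which is unbounded unless [t = 0]. *)
Lemma iter_expanding (t : R) :
    1 < q ->
    (forall s, `|s| < eta ->
       exists2 m, q <= `|m| & g (a + s *: w) = a + (m * s) *: w) ->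
    (forall n u, iter n g (a + t *: w) = a + u *: w -> `|u| < eta) ->
  t = 0.
Proof.
move=> q1 gq t_eta; have q0 : 0 < q by exact: lt_trans q1.
have grow n : exists2 u, q ^+ n * `|t| <= `|u| &
    iter n g (a + t *: w) = a + u *: w.
  elim: n => [|n [u un IHn]]; first by exists t => //; rewrite expr0 mul1r.
  have [m mq gu] := gq u (t_eta n u IHn).
  exists (m * u); last by rewrite iterS IHn.
  by rewrite normrM exprS -mulrA ler_pM ?mulr_ge0 ?exprn_ge0// ltW.
have bound n : `|t| <= geometric eta q^-1 n.
  have [u un /t_eta u_eta] := grow n.
  rewrite /= exprVn ler_pdivlMr ?exprn_gt0// mulrC ltW//.
  exact: le_lt_trans u_eta.
have cvg0 : geometric eta q^-1 @ \oo --> (0 : R).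
  by apply: cvg_geometric; rewrite gtr0_norm ?invr_gt0// invf_lt1.
apply/eqP; rewrite -normr_eq0 eq_le normr_ge0 andbT.
rewrite -(cvg_lim _ cvg0)//; apply: limr_ge; first by apply/cvg_ex; exists 0.
by near=> n; exact: bound.
Unshelve. all: by end_near. Qed.

End line_iteration.

(** * The map near a ray of fixed points *)

Section fixed_ray.
Context {R : realType}.
Variables (g : 'rV[R]_2 -> 'rV[R]_2) (ystar : 'rV[R]_2).
Hypotheses (g_diff : forall y, pos_quadrant R y -> differentiable g y)
  (g_total : forall y, pos_quadrant R y -> total (g y) = total y)
  (ystar_pos : pos_quadrant R ystar)
  (ray_fixed : forall r : R, 0 < r -> g (r *: ystar) = r *: ystar).

(** The eigenvalue of the Jacobian on [transfer], read on the first coordinate,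
    where [transfer] is 1. *)
Definition multiplier : R := ('D_transfer g ystar) 0 0.

Lemma jacobian_ray : ystar *m 'J g ystar = ystar.
Proof.
rewrite -deriveEjacobian ?derive_affine//; last exact: g_diff.
have := @nbhs0_lt R R^o 1 ltr01; apply: filterS => h h1.
have {}h1 : 0 < h + 1.
  by move: h1; rewrite ltr_norml -ltrBlDr sub0r => /andP[].
have := ray_fixed h1; rewrite scalerDl scale1r => ->.
by have := ray_fixed ltr01; rewrite scale1r => ->.
Qed.

(** The directional derivatives of [g] at [ystar] have the total of their
    direction, so the one along [transfer] has total 0 and is a multiple of
    [transfer]. *)
Lemma jacobian_transfer :
  transfer *m 'J g ystar = multiplier *: transfer.
Proof.
rewrite -deriveEjacobian; last exact: g_diff.
apply: total0_transfer; rewrite total_derive ?total_transfer//.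
  by apply: diff_derivable; exact: g_diff.
have : \forall x \near ystar, pos_quadrant R x.
  exact: open_nbhs_nbhs (conj (@pos_quadrant_open R) ystar_pos).
by apply: filterS => x; exact: g_total.
Qed.

(** On the line through [r *: ystar], the map is [t |-> m * t] with [m] the
    derivative along [transfer] at some point between [r *: ystar] and the
    given point. That point is close to [ystar], uniformly in [r], so [m] is
    close to the derivative at [ystar]. *)
Lemma local_multiplier (e : R) :
    {for ystar, continuous ('D_transfer g)} -> 0 < e ->
  exists2 eta : R, 0 < eta &
    forall r t : R, `|r - 1| < eta -> `|t| < eta ->
    exists2 m : R, `|m - multiplier| < e &
      g (r *: ystar + t *: transfer) = r *: ystar + (m * t) *: transfer.
Proof.
move=> dg e0.
have : \forall y \near ystar,
    pos_quadrant R y /\ `|('D_transfer g y) 0 0 - multiplier| < e.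
  near=> y; split.
    near: y.
    exact: open_nbhs_nbhs (conj (@pos_quadrant_open R) ystar_pos).
  near: y.
  have dg0 : ('D_transfer g y) 0 0 @[y --> ystar] --> multiplier.
    exact: cvg_coord dg.
  exact: (@cvgr_distC_lt _ _ _ (nbhs ystar) _ _ _ dg0).
move=> /nbhs_normP[d /= d0 near_ystar].
pose c : R := `|ystar| + `|transfer : 'rV[R]_2| + 1.
have c0 : 0 < c by rewrite ltr_wpDl// addr_ge0.
exists (d / c) => [|r t r_eta t_eta]; first by rewrite divr_gt0.
have box s : `|s| < d / c ->
    pos_quadrant R (r *: ystar + s *: transfer) /\
    `|('D_transfer g (r *: ystar + s *: transfer)) 0 0 - multiplier| < e.
  move=> s_eta; apply: near_ystar => /=; rewrite distrC.
  have -> : r *: ystar + s *: transfer - ystar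
      = (r - 1) *: ystar + s *: transfer.
    by rewrite scalerBl scale1r addrAC.
  rewrite (le_lt_trans (ler_normD _ _))// !normrZ.
  apply: (@le_lt_trans _ _ (d / c * (`|ystar| + `|transfer : 'rV[R]_2|))).
    by rewrite mulrDr lerD// ler_wpM2r// ltW.
  by rewrite mulrAC ltr_pdivrMr// ltr_pM2l// ltrDl.
(* r is positive since r *: ystar + t *: transfer has a positive total. *)
have r0 : 0 < r.
  have [/total_gt0 + _] := box t t_eta.
  rewrite totalD !totalZ total_transfer mulr0 addr0 pmulr_lgt0//.
  exact: total_gt0.
have segE s : s *: (t *: transfer) + r *: ystar
    = r *: ystar + (s * t) *: transfer :> 'rV[R]_2.
  by rewrite scalerA addrC.
have seg (s : R) : 0 <= s <= 1 -> `|s * t| < d / c.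
  move=> /andP[s0 s1]; rewrite normrM ger0_norm// (le_lt_trans _ t_eta)//.
  by rewrite ler_piMl.
have [s s01|s s01 gE] := @segment_mean_value R g (r *: ystar) (t *: transfer) 0.
  by rewrite segE; apply: g_diff; have [] := box _ (seg s s01).
have [zpos zm] := box _ (seg s s01).
exists (('D_transfer g (r *: ystar + (s * t) *: transfer)) 0 0) => //.
rewrite -[LHS](subrK (r *: ystar)) addrC; congr (_ + _).
rewrite [LHS]total0_transfer; last first.
  rewrite totalB g_total; last by have [] := box t t_eta.
  by rewrite totalD !totalZ total_transfer mulr0 addr0 subrr.
congr (_ *: _); rewrite !mxE [_ + t *: _]addrC gE ray_fixed// segE.
rewrite !deriveEjacobian; [|exact: g_diff..].
by rewrite -scalemxAl !mxE addrC addKr mulrC.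
Unshelve. all: by end_near. Qed.

(** The ratio [q] is the midpoint of the multiplier's modulus and 1. *)
Lemma contraction_near (dg : {for ystar, continuous ('D_transfer g)}) :
    `|multiplier| < 1 ->
  exists q eta : R, [/\ 0 <= q < 1, 0 < eta &
    forall r t : R, `|r - 1| < eta -> `|t| < eta ->
    forall n, exists2 u : R, `|u| <= q ^+ n * `|t| &
      iter n g (r *: ystar + t *: transfer) = r *: ystar + u *: transfer].
Proof.
move=> rho1; have rho0 := normr_ge0 multiplier.
have [|eta eta0 geta] := @local_multiplier ((1 - `|multiplier|) / 2) dg.
  by rewrite divr_gt0// subr_gt0.
exists ((1 + `|multiplier|) / 2), eta; split => //; first lra.
move=> r t r_eta t_eta; apply: (@iter_contracting _ _ g _ _ _ eta) => //.
  by lra.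
move=> s s_eta; have [m m_rho gs] := geta r s r_eta s_eta.
exists m => //; rewrite -(subrK multiplier m) (le_trans (ler_normD _ _))//.
lra.
Qed.

(** An orbit on the line of [ystar] that stays near [ystar] is the fixed point:
    any other one is repelled with ratio the midpoint of 1 and the multiplier's
    modulus. *)
Lemma expansion_near (dg : {for ystar, continuous ('D_transfer g)}) :
    1 < `|multiplier| ->
  exists2 eta : R, 0 < eta &
    forall t : R, `|t| < eta ->
    (forall (n : nat) (u : R),
       iter n g (ystar + t *: transfer) = ystar + u *: transfer ->
       `|u| < eta) ->
    t = 0.
Proof.
move=> rho1.
have [|eta eta0 geta] := @local_multiplier ((`|multiplier| - 1) / 2) dg.
  by rewrite divr_gt0// subr_gt0.
exists eta => // t t_eta.
apply: (@iter_expanding _ _ g _ _ ((`|multiplier| + 1) / 2)).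
  by lra.
move=> s s_eta; have [|m m_rho] := geta 1 s _ s_eta.
  by rewrite subrr normr0.
rewrite scale1r => gs; exists m => //.
have := lerB_normD multiplier (m - multiplier); rewrite subrKC.
lra.
Qed.

(** Closeness to [ystar] in the norm [N] bounds both [r - 1], through the total
    of [y - ystar], and then [t], through its first coordinate. *)
Lemma ray_coordinates (N : 'rV[R]_2 -> R) : is_norm N ->
  exists2 K : R, 0 < K & forall y, exists r t : R,
    [/\ y = r *: ystar + t *: transfer, r = total y / total ystar,
        `|r - 1| <= K * N (y - ystar) & `|t| <= K * N (y - ystar)].
Proof.
move=> Nn; have [C C0 NC] := is_norm_ge Nn.
have T0 := total_gt0 ystar_pos; set T := total ystar in T0 *.
pose A := 2 * C / T.
have A0 : 0 < A by rewrite divr_gt0// mulr_gt0.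
exists (A + C + A * `|ystar|) => [|y].
  by rewrite ltr_wpDr// ?addr_gt0// mulr_ge0// ltW.
have N0 := is_norm_ge0 (y - ystar) Nn.
set r := total y / T.
have r1 : `|r - 1| <= A * N (y - ystar).
  have -> : r - 1 = total (y - ystar) / T.
    by rewrite totalB mulrBl divff ?gt_eqF.
  rewrite normrM normfV (gtr0_norm T0) ler_pdivrMr//.
  have -> : A * N (y - ystar) * T = C * N (y - ystar) + C * N (y - ystar).
    by rewrite /A; field; rewrite gt_eqF.
  rewrite (le_trans (ler_normD _ _))// lerD//.
    exact: le_trans (ler_coord_norm _ _) (NC _).
  exact: le_trans (ler_coord_norm _ _) (NC _).
exists r, ((y - r *: ystar) 0 0); split => //.
- exact: total_decomposition (lt0r_neq0 T0).
- rewrite (le_trans r1)// ler_wpM2r// -addrA lerDl.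
  exact: addr_ge0 (ltW C0) (mulr_ge0 (ltW A0) (normr_ge0 _)).
- have -> : (y - r *: ystar) 0 0 = (y - ystar) 0 0 - (r - 1) * ystar 0 0.
    by rewrite !mxE; ring.
  rewrite (le_trans (ler_normB _ _))// normrM.
  rewrite !mulrDl -addrA ler_wpDl ?(mulr_ge0 (ltW A0))// lerD//.
    exact: le_trans (ler_coord_norm _ _) (NC _).
  by rewrite mulrAC ler_pM// ler_coord_norm.
Qed.

End fixed_ray.

(** * Stability and local convergence *)

(* Part b) carries the hypothesis [`|rho| <> 1], absent from the source: without
   it, b) is refuted by the identity map (rho = 1). *)
Theorem theorem2p9 (R : realType) (N : 'rV[R]_2 -> R)
    (g : 'rV[R]_2 -> 'rV[R]_2) (ystar : 'rV[R]_2)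
    (N_norm : is_norm N)
    (g_pos : forall y, pos_quadrant R y -> pos_quadrant R (g y))
    (g_C2 : Ck_on (pos_quadrant R) 2 g)
    (ystar_pos : pos_quadrant R ystar)
    (ystar_fixed : g ystar = ystar)
    (ray_fixed : forall r : R, 0 < r -> g (r *: ystar) = r *: ystar)
    (norm1_iter : forall y0, pos_quadrant R y0 ->
       forall n : nat, norm1 (iter n.+1 g y0) = norm1 (iter n g y0)) :
  exists rho : R,
    [/\ spectrum ('J g ystar) = [set 1; rho%:C],
        `|rho| < 1 -> lyapunov_stable N (pos_quadrant R) g ystar &
        `|rho| <> 1 -> lyapunov_stable N (pos_quadrant R) g ystar ->
          exists2 delta : R, 0 < delta &
            forall y0, pos_quadrant R y0 ->
              norm1 y0 = norm1 ystar -> N (y0 - ystar) < delta ->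
              (fun n : nat => iter n g y0) @ \oo --> ystar].
Proof.
have [g_diff dg_C1] := g_C2.
have dg : {for ystar, continuous ('D_transfer g)}.
  by apply: differentiable_continuous; have [+ _] := dg_C1 transfer; exact.
have g_total y : pos_quadrant R y -> total (g y) = total y.
  move=> ypos; rewrite -!norm1_total//; last exact: g_pos.
  exact: (norm1_iter y ypos 0).
have T0 := total_gt0 ystar_pos.
have [K K0 coordK] := @ray_coordinates _ _ ystar_pos _ N_norm.
exists (multiplier g ystar); split.
- apply: (@spectrum_transfer _ _ ystar); first by rewrite gt_eqF.
    exact: jacobian_ray.
  exact: jacobian_transfer.
- move=> rho1.
  have [q [eta [/andP[q0 q1] eta0 geta]]] :=
    contraction_near g_diff g_total ystar_pos ray_fixed dg rho1.
  have [ND NZ _] := N_norm.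
  move=> eps eps0.
  pose c := N ystar + N transfer + 1.
  have c0 : 0 < c by rewrite ltr_wpDl// addr_ge0// is_norm_ge0.
  (* r - 1 and t below e stay where the contraction holds, and keep the
     orbit within eps. *)
  pose e := Num.min eta (eps / c).
  have e0 : 0 < e by rewrite lt_min eta0 divr_gt0.
  exists (e / K) => [|y0 y0pos y0near n]; first by rewrite divr_gt0.
  have Ke : K * N (y0 - ystar) < e by rewrite mulrC -ltr_pdivlMr.
  have [r [t [y0E _ /le_lt_trans/(_ Ke) re /le_lt_trans/(_ Ke) te]]] :=
    coordK y0.
  rewrite {}y0E; have [||u ut ->] := geta r t _ _ n.
  + by rewrite (lt_le_trans re)// ge_min lexx.
  + by rewrite (lt_le_trans te)// ge_min lexx.
  have ue : `|u| < e.
    rewrite (le_lt_trans ut)// (le_lt_trans _ te)// ler_piMl//.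
    by rewrite exprn_ile1// ltW.
  have -> : r *: ystar + u *: transfer - ystar
      = (r - 1) *: ystar + u *: transfer.
    by rewrite scalerBl scale1r addrAC.
  rewrite (le_lt_trans (ND _ _))// !NZ.
  apply: (@le_lt_trans _ _ (e * (N ystar + N transfer))).
    by rewrite mulrDr lerD// ler_wpM2r ?is_norm_ge0// ltW.
  apply: (@lt_le_trans _ _ (e * c)); first by rewrite ltr_pM2l// ltrDl.
  by rewrite -ler_pdivlMr// ge_min lexx orbT.
- move=> rho1 stable.
  have on_line y0 : pos_quadrant R y0 -> norm1 y0 = norm1 ystar ->
      exists2 t, y0 = ystar + t *: transfer & `|t| <= K * N (y0 - ystar).
    move=> y0pos; rewrite !norm1_total// => y0T.
    have [r [t [y0E rE _ tK]]] := coordK y0.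
    by exists t => //; rewrite {1}y0E rE y0T divff ?gt_eqF// scale1r.
  have [rho_lt1|rho_gt1|//] := ltgtP `|multiplier g ystar| 1.
    have [q [eta [/andP[q0 q1] eta0 geta]]] :=
      contraction_near g_diff g_total ystar_pos ray_fixed dg rho_lt1.
    exists (eta / K) => [|y0 y0pos y0T y0near]; first by rewrite divr_gt0.
    have [t y0E tK] := on_line y0 y0pos y0T.
    have t_eta : `|t| < eta.
      by rewrite (le_lt_trans tK)// mulrC -ltr_pdivlMr.
    rewrite {}y0E.
    have geo : geometric (`|t| * `|transfer : 'rV[R]_2|) q @ \oo --> (0 : R).
      by apply: cvg_geometric; rewrite (ger0_norm q0).
    apply/(@cvgrPdistC_lt _ _ _ \oo) => e e0; near=> n.
    have [|u ut] := geta 1 t _ t_eta n; first by rewrite subrr normr0.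
    rewrite scale1r => ->; rewrite addrAC subrr add0r normrZ.
    apply: (@le_lt_trans _ _ (geometric (`|t| * `|transfer : 'rV[R]_2|) q n)).
      by rewrite /= mulrAC ler_wpM2r// mulrC.
    by near: n; exact: (@cvgr_lt _ _ \oo _ _ _ geo).
  have [eta eta0 geta] :=
    expansion_near g_diff g_total ystar_pos ray_fixed dg rho_gt1.
  have [C C0 NC] := is_norm_ge N_norm.
  have [d d0 stay] := stable (eta / C) (divr_gt0 eta0 C0).
  exists (Num.min d (eta / K)) => [|y0 y0pos y0T].
    by rewrite lt_min d0 divr_gt0.
  rewrite lt_min => /andP[/(stay y0 y0pos) {}stay y0near].
  have [t y0E tK] := on_line y0 y0pos y0T.
  (* Stability within eta / C keeps the transfer coordinate below eta. *)
  have t0 : t = 0.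
    apply: geta.
      by rewrite (le_lt_trans tK)// mulrC -ltr_pdivlMr.
    move=> n u; rewrite -y0E => yn.
    have := stay n; rewrite yn addrAC subrr add0r ltr_pdivlMr// mulrC.
    apply: le_lt_trans; apply: le_trans (NC _).
    by have := ler_coord_norm (u *: transfer) 0; rewrite mxE transfer00 mulr1.
  have -> : (fun n => iter n g y0) = cst ystar.
    apply/funext; elim=> [|n /= ->//].
    by rewrite /= y0E t0 scale0r addr0.
  exact: cvg_cst.
Unshelve. all: by end_near. Qed.
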